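(* Let $D$, $D_1$, $D_2$ be virtual link diagrams and let $D_1\sqcup D_2$ denote the disconnected sum of the diagrams $D_1$ and $D_2$. Then the following hold. (a) $Z_D(x,y)=\widetilde{Z}_D(x,y)=0$ if $D$ has no virtual crossings; (b) $Z_{D_1\sqcup D_2}(x,y)=Z_{D_1}(x,y)\,Z_{D_2}(x,y)$ and $\widetilde{Z}_{D_1\sqcup D_2}(x,y)=\widetilde{Z}_{D_1}(x,y)\,\widetilde{Z}_{D_2}(x,y)$.
   Context: A virtual link diagram is an oriented link diagram in the plane (an oriented 4-valent plane graph, closed curves without vertices being allowed) each of whose crossings is either classical (with over/under information, hence positive or negative in the usual sense) or virtual (no over/under information). At each crossing the two strands pass transversally through each other. The disconnected sum $D_1\sqcup D_2$ is the diagram obtained by placing $D_1$ and $D_2$ in disjoint disks of the plane. Definition of $Z_D$. Let $D$ have $n\ge 1$ classical crossings $c_1,\dots,c_n$. Put $$M_+ = \begin{pmatrix} 1-x & -y \\ -xy^{-1} & 0\end{pmatrix},\qquad M_- = \begin{pmatrix} 0 & -x^{-1}y \\ -y^{-1} & 1-x^{-1}\end{pmatrix}.$$ Let $M_i = M_+$ if $c_i$ is positive and $M_i=M_-$ otherwise, and let $M=\mathrm{diag}(M_1,\dots,M_n)$, a $2n\times 2n$ block diagonal matrix. Ignoring virtual crossings, $D$ gives a graph with $n$ vertices $v_1,\dots,v_n$ (the classical crossings) and $2n$ edges (the arcs connecting two classical crossings, which may intersect in virtual crossings). Subdivide each edge into two half-edges. At $v_i$, rotate the picture so that both strands point downwards;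 label the upper left, upper right (incoming) half-edges $i_l^-$, $i_r^-$ and the lower left, lower right (outgoing) half-edges $i_l^+$, $i_r^+$. A permutation of $\{1,\dots,n\}\times\{l,r\}$ is defined by $(i,a)\mapsto(j,b)$ if the half-edges $i_a^+$ and $j_b^-$ belong to the same edge. Let $P$ be the corresponding $2n\times 2n$ permutation matrix (entry $1$ in column $(i,a)$ and row $(j,b)$ when $(i,a)\mapsto(j,b)$), with rows and columns ordered $(1,l),(1,r),(2,l),(2,r),\dots,(n,l),(n,r)$. Let $w(D)$ be the writhe (number of positive minus number of negative classical crossings), and define $$Z_D(x,y) = (-1)^{w(D)}\det(M-P)\in\mathbb{Z}[x^{\pm1},y^{\pm1}].$$ If $D$ has no classical crossings, put $Z_D(x,y)=0$. Normalized polynomial. If $Z_D(x,y)\neq 0$ and $N$ is the lowest exponent of the variable $x$ occurring in $Z_D(x,y)$, put $\widetilde{Z}_D(x,y)=x^{-N}Z_D(x,y)$; otherwise put $\widetilde{Z}_D(x,y)=Z_D(x,y)=0$.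
   Formalization: Part (b) additionally assumes that if one of D_1, D_2 has no classical crossings then the other has Z = 0; without this (b) fails, e.g. for D_1 a crossingless circle and Z_{D_2} nonzero, since Z_{D_1} = 0 by convention while Z of the sum is Z_{D_2}. *)

(* Defs.v *)
From mathcomp Require Import all_boot all_order all_algebra all_fingroup.
From mathcomp Require Import fraction finmap.

Set Implicit Arguments.
Unset Strict Implicit.
Unset Printing Implicit Defensive.

Import Order.TTheory GRing.Theory Num.Theory.

Local Open Scope ring_scope.

(* Every crossing is drawn with both strands pointing downwards, so that it   *)
(* has an upper left, an upper right (incoming) and a lower left, a lower     *)
(* right (outgoing) half-edge.  Sides are indexed by 'I_2 and [rev_ord]       *)
(* exchanges them: a strand entering on the side a leaves on the side         *)
(* [rev_ord a].                                                               *)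
Notation side := 'I_2 (only parsing).
Definition lft : side := ord0.
Definition rgt : side := ord_max.

(* An oriented 4-valent plane graph with vertex set V is described by the     *)
(* bijection [arc] sending (u, a) to (v, b) if the half-edge leaving u on its *)
(* lower side a and the half-edge entering v on its upper side b belong to    *)
(* the same edge.  Its half-edges (darts) are the triples (v, a, up), where   *)
(* [up] tells incoming from outgoing half-edges; they form the hypermap with  *)
(* permutations [dart_edge] (other half of the edge) and [dart_node] (next    *)
(* half-edge in counterclockwise order around the crossing).                  *)
Section PlaneGraph.

Variables (V : finType) (arc : {perm V * side}).

Definition dart : finType := (V * side * bool)%type.

Definition dart_edge (d : dart) : dart :=
  let: (h, up) := d in if up then (arc^-1%g h, false) else (arc h, true).

Definition dart_node (d : dart) : dart :=
  let: (v, a, up) := d in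
  if a == lft then if up then (v, lft, false) else (v, rgt, false)
  else if up then (v, lft, true) else (v, rgt, true).

Definition dart_face (d : dart) : dart := dart_node (dart_edge d).

Definition dart_link : rel dart :=
  [rel d d' | (dart_edge d == d') || (dart_node d == d')].

(* Euler's formula V - E + F = 2 C, with 2 E = #|dart|: the hypermap has      *)
(* genus 0, that is, it is the hypermap of a graph drawn in the plane.  The   *)
(* relative position of the connected components is not recorded.            *)
Definition planar : Prop :=
  (fcard dart_edge dart + fcard dart_node dart + fcard dart_face dart
   = 2 * n_comp dart_link dart + #|dart|)%N.

End PlaneGraph.

(* [over v] is [Some a] if v is classical and its overcrossing strand enters  *)
(* on the side a, and [None] if v is virtual.  [circles] is the number of     *)
(* closed curves without vertices.                                            *)
Record diagram := Diagram {
  crossing : finType;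
  over : crossing -> option side;
  arc : {perm crossing * side};
  circles : nat;
  arc_planar : planar arc
}.

Definition classical (D : diagram) : pred (crossing D) := fun v => over v != None.

(* With both strands pointing downwards, the crossing is positive if and only *)
(* if the overcrossing strand runs from the upper right to the lower left.    *)
Definition positive (D : diagram) : pred (crossing D) :=
  fun v => over v == Some rgt.
Definition negative (D : diagram) : pred (crossing D) :=
  fun v => over v == Some lft.

Definition ncrossings (D : diagram) : nat := #|@classical D|.

Definition writhe (D : diagram) : int :=
  #|@positive D|%:Z - #|@negative D|%:Z.

Definition cr (D : diagram) (i : 'I_(ncrossings D)) : crossing D := enum_val i.

(* Arriving at a virtual crossing, a strand passes transversally to the       *)
(* opposite side and goes on to the end of the next arc; at a classical       *)
(* crossing it stops.                                                         *)
Definition virtual_step (D : diagram) : rel (crossing D * side) :=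
  [rel h h' | ~~ classical h.1 && (arc D (h.1, rev_ord h.2) == h')].

(* The half-edge leaving cr i on the lower side a and the one entering cr j   *)
(* on the upper side b belong to the same edge once virtual crossings are     *)
(* ignored.                                                                   *)
Definition same_edge (D : diagram)
    (i : 'I_(ncrossings D)) (a : side) (j : 'I_(ncrossings D)) (b : side) : bool :=
  connect (@virtual_step D) (arc D (cr i, a)) (cr j, b).

Section SumGraph.

Variables (V1 V2 : finType) (arc1 : {perm V1 * side}) (arc2 : {perm V2 * side}).

Definition sum_arc_fun (h : (V1 + V2) * side) : (V1 + V2) * side :=
  match h with
  | (inl v, a) => let: (w, b) := arc1 (v, a) in (inl w, b)
  | (inr v, a) => let: (w, b) := arc2 (v, a) in (inr w, b)
  end.

Lemma sum_arc_inj : injective sum_arc_fun.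
Proof.
move=> [[v|v] a] [[w|w] b] /=.
- case E: (arc1 (v, a)) => [v' a']; case E': (arc1 (w, b)) => [w' b'] [ev ea].
  by move: E; rewrite ev ea -E' => /perm_inj[-> ->].
- by case: (arc1 _) => ? ?; case: (arc2 _).
- by case: (arc2 _) => ? ?; case: (arc1 _).
case E: (arc2 (v, a)) => [v' a']; case E': (arc2 (w, b)) => [w' b'] [ev ea].
by move: E; rewrite ev ea -E' => /perm_inj[-> ->].
Qed.

Definition sum_arc : {perm (V1 + V2) * side} := perm sum_arc_inj.

Let in1 (d : dart V1) : dart (V1 + V2)%type := (inl d.1.1, d.1.2, d.2).
Let in2 (d : dart V2) : dart (V1 + V2)%type := (inr d.1.1, d.1.2, d.2).

Lemma dart_edge_inj (V : finType) (s : {perm V * side}) : injective (dart_edge s).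
Proof.
by move=> [h u] [k w] /=; case: u w => [] [] // [] /perm_inj ->.
Qed.

Lemma dart_node_inj (V : finType) : injective (@dart_node V).
Proof.
move=> [[v a] u] [[w b] t] /=.
case: a b => [[|[|//]] pa] [[|[|//]] pb]; case: u t => [] [] //= [->];
  by congr (_, _, _); apply: val_inj.
Qed.

Lemma dart_face_inj (V : finType) (s : {perm V * side}) : injective (dart_face s).
Proof. by move=> d d' /dart_node_inj/dart_edge_inj. Qed.

Lemma dart_link_sym (V : finType) (s : {perm V * side}) :
  connect_sym (dart_link s).
Proof.
apply: relU_sym; apply: fconnect_sym; [exact: dart_edge_inj | exact: dart_node_inj].
Qed.

Lemma n_comp_sum (e : rel (dart (V1 + V2)%type)) (e1 : rel (dart V1)) (e2 : rel (dart V2)) :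
    connect_sym e -> connect_sym e1 -> connect_sym e2 ->
    (forall d d', e (in1 d) (in1 d') = e1 d d') ->
    (forall d d', e (in2 d) (in2 d') = e2 d d') ->
    (forall d d', e (in1 d) (in2 d') = false) ->
    (forall d d', e (in2 d) (in1 d') = false) ->
  n_comp e (dart (V1 + V2)%type) = (n_comp e1 (dart V1) + n_comp e2 (dart V2))%N.
Proof.
move=> se se1 se2 H1 H2 H12 H21.
pose a : {pred dart (V1 + V2)%type} := [pred d | if d.1.1 is inl _ then true else false].
have cl : closed e a.
  move=> [[[v|v] s] u] [[[w|w] t] z] //= h; rewrite /in_mem /=.
    by move: (H12 (v, s, u) (w, t, z)); rewrite h.
  by move: (H21 (v, s, u) (w, t, z)); rewrite h.
have clC : closed e [predC a].
  by move=> x y /cl; rewrite !inE => ->.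
have i1 : injective in1 by move=> [[v s] u] [[w t] z] [-> -> ->].
have i2 : injective in2 by move=> [[v s] u] [[w t] z] [-> -> ->].
rewrite (n_compC a); congr (_ + _)%N.
  rewrite (adjunction_n_comp in1 se se1 cl); first by apply: eq_n_comp_r => -[[v s] u].
  apply: strict_adjunction => //.
  by apply/subsetP => -[[[v|v] s] u] // _; apply/codomP; exists (v, s, u).
rewrite (adjunction_n_comp in2 se se2 clC); first by apply: eq_n_comp_r => -[[v s] u].
apply: strict_adjunction => //.
by apply/subsetP => -[[[v|v] s] u] // _; apply/codomP; exists (v, s, u).
Qed.

Lemma sum_arcV1 v a :
  (sum_arc^-1)%g (inl v, a) = let: (w, b) := (arc1^-1)%g (v, a) in (inl w, b).
Proof.
apply: (@perm_inj _ sum_arc); rewrite permKV permE /=.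
case E: ((arc1^-1)%g (v, a)) => [w b] /=.
by rewrite -E permKV.
Qed.

Lemma sum_arcV2 v a :
  (sum_arc^-1)%g (inr v, a) = let: (w, b) := (arc2^-1)%g (v, a) in (inr w, b).
Proof.
apply: (@perm_inj _ sum_arc); rewrite permKV permE /=.
case E: ((arc2^-1)%g (v, a)) => [w b] /=.
by rewrite -E permKV.
Qed.

Lemma dart_edge_in1 d : dart_edge sum_arc (in1 d) = in1 (dart_edge arc1 d).
Proof.
case: d => [[v a] []]; rewrite /in1 /=.
  by rewrite sum_arcV1; case: ((arc1^-1)%g _).
by rewrite permE /=; case: (arc1 _).
Qed.

Lemma dart_edge_in2 d : dart_edge sum_arc (in2 d) = in2 (dart_edge arc2 d).
Proof.
case: d => [[v a] []]; rewrite /in2 /=.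
  by rewrite sum_arcV2; case: ((arc2^-1)%g _).
by rewrite permE /=; case: (arc2 _).
Qed.

Lemma dart_node_in1 d : dart_node (in1 d) = in1 (dart_node d).
Proof. by case: d => [[v a] []] /=; case: eqP. Qed.

Lemma dart_node_in2 d : dart_node (in2 d) = in2 (dart_node d).
Proof. by case: d => [[v a] []] /=; case: eqP. Qed.

#[local] Arguments dart_edge : simpl never.
#[local] Arguments dart_node : simpl never.

Lemma sum_planar : planar arc1 -> planar arc2 -> planar sum_arc.
Proof.
have q1 d d' : (in1 d == in1 d') = (d == d').
  by apply/eqP/eqP => [|-> //]; move: d d' => [[v s] u] [[w t] z] [-> -> ->].
have q2 d d' : (in2 d == in2 d') = (d == d').
  by apply/eqP/eqP => [|-> //]; move: d d' => [[v s] u] [[w t] z] [-> -> ->].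
have q12 d d' : (in1 d == in2 d') = false by apply/eqP.
have q21 d d' : (in2 d == in1 d') = false by apply/eqP.
have E := (dart_edge_in1, dart_edge_in2, dart_node_in1, dart_node_in2, q1, q2, q12, q21).
rewrite /planar => p1 p2.
have cE : fcard (dart_edge sum_arc) (dart (V1 + V2)%type)
          = (fcard (dart_edge arc1) (dart V1) + fcard (dart_edge arc2) (dart V2))%N.
  apply: n_comp_sum; try (by apply: fconnect_sym; apply: dart_edge_inj);
    by move=> d d'; rewrite /= !E.
have cN : fcard (@dart_node _) (dart (V1 + V2)%type)
          = (fcard (@dart_node _) (dart V1) + fcard (@dart_node _) (dart V2))%N.
  apply: n_comp_sum; try (by apply: fconnect_sym; apply: dart_node_inj);
    by move=> d d'; rewrite /= !E.
have cF : fcard (dart_face sum_arc) (dart (V1 + V2)%type)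
          = (fcard (dart_face arc1) (dart V1) + fcard (dart_face arc2) (dart V2))%N.
  apply: n_comp_sum; try (by apply: fconnect_sym; apply: dart_face_inj);
    by move=> d d'; rewrite /= /dart_face !E.
have cL : n_comp (dart_link sum_arc) (dart (V1 + V2)%type)
          = (n_comp (dart_link arc1) (dart V1) + n_comp (dart_link arc2) (dart V2))%N.
  apply: n_comp_sum; try exact: dart_link_sym;
    by move=> d d'; rewrite /dart_link /= !E.
have -> : #|dart (V1 + V2)%type| = (#|dart V1| + #|dart V2|)%N.
  by rewrite !card_prod card_sum !mulnDl.
rewrite cE cN cF cL mulnDr [RHS]addnACA -p1 -p2 [RHS]addnACA.
by congr (_ + _)%N; exact: addnACA.
Qed.

End SumGraph.

Definition dsum (D1 D2 : diagram) : diagram :=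
  @Diagram (crossing D1 + crossing D2)%type
    (fun v => match v with inl v1 => over v1 | inr v2 => over v2 end)
    (sum_arc (arc D1) (arc D2))
    (circles D1 + circles D2)
    (sum_planar (arc_planar D1) (arc_planar D2)).

(* Z[x^{+-1}, y^{+-1}] is regarded as a subring of the field Z(x, y) of       *)
(* fractions of Z[y][x].                                                      *)
Notation ratxy := {fraction {poly {poly int}}}.
Definition x : ratxy := FracField.tofrac 'X.
Definition y : ratxy := FracField.tofrac ('X)%:P.

Definition mx2 (a b c d : ratxy) : 'M[ratxy]_2 :=
  \matrix_(i, j) if i == lft then if j == lft then a else b
                 else if j == lft then c else d.

Definition Mpos : 'M[ratxy]_2 := mx2 (1 - x)            (- y)
                                     (- (x * y^-1))     0.
Definition Mneg : 'M[ratxy]_2 := mx2 0                  (- (x^-1 * y))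
                                     (- y^-1)           (1 - x^-1).

Definition Mmat (D : diagram) :=
  \mxdiag_(i < ncrossings D) (if positive (cr i) then Mpos else Mneg).

Definition Pmat (D : diagram) :=
  \mxblock_(j < ncrossings D, i < ncrossings D)
     (\matrix_(b < 2, a < 2) (same_edge i a j b)%:R : 'M[ratxy]_2).

Definition Z (D : diagram) : ratxy :=
  if ncrossings D == 0 then 0 else (-1) ^ writhe D * \det (Mmat D - Pmat D).

(* A Laurent polynomial is given by its finitely supported family of          *)
(* coefficients, (i, j) being the index of x^i y^j.                           *)
Notation coefs := {fsfun int * int -> int with 0}.

Definition laurent (c : coefs) : ratxy :=
  \sum_(e <- finsupp c) (c e)%:~R * x ^ e.1 * y ^ e.2.

Definition lowest_exponent_x (c : coefs) : int :=
  head 0 (sort <=%O [seq e.1 | e <- finsupp c]).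

Section LaurentClosure.

Let mono (t : int * (int * int)) : ratxy := t.1%:~R * x ^ t.2.1 * y ^ t.2.2.
Let isL (f : ratxy) := exists s : seq (int * (int * int)), f = \sum_(t <- s) mono t.

Lemma x_neq0 : x != 0.
Proof. by rewrite /x tofrac_eq0 polyX_eq0. Qed.
Lemma y_neq0 : y != 0.
Proof. by rewrite /y tofrac_eq0 polyC_eq0 polyX_eq0. Qed.

Lemma laurent_of_list f : isL f -> exists c, f == laurent c.
Proof.
case=> s ->; pose S := [fset t.2 | t in s]%fset.
pose g (e : int * int) := \sum_(t <- s | t.2 == e) t.1.
exists [fsfun e in S => g e]; rewrite /laurent; apply/eqP.
rewrite finsupp_fsfun.
have mem t : t \in s -> t.2 \in S by move=> h; apply/imfsetP; exists t.
transitivity (\sum_(e <- S) (g e)%:~R * x ^ e.1 * y ^ e.2).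
  rewrite (eq_big_seq (fun t => \sum_(e <- S | e == t.2) mono t)); last first.
    move=> t ts; rewrite -big_filter filter_pred1_uniq ?fset_uniq ?mem //.
    by rewrite big_seq1.
  rewrite (exchange_big_dep predT) //=; apply: eq_bigr => e _.
  rewrite /g rmorph_sum /= !mulr_suml; apply: eq_big => [t|t /eqP ->] //=.
rewrite [LHS]big_seq [RHS]big_fset /= [RHS]big_seq_cond.
rewrite [LHS](bigID (fun e => g e != 0)) /= [X in _ + X]big1 ?addr0; last first.
  by move=> e /andP[_]; rewrite negbK => /eqP ->; rewrite !mul0r.
by apply: eq_big => // e /andP[eS _]; rewrite fsfun_fun eS.
Qed.

Lemma isL_mono n i j : isL (n%:~R * x ^ i * y ^ j).
Proof. by exists [:: (n, (i, j))]; rewrite big_seq1. Qed.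

Lemma isL_int n : isL n%:~R.
Proof. by have := isL_mono n 0 0; rewrite !expr0z !mulr1. Qed.

Lemma isL_add f g : isL f -> isL g -> isL (f + g).
Proof. by move=> [s ->] [t ->]; exists (s ++ t); rewrite big_cat. Qed.

Lemma isL_mul f g : isL f -> isL g -> isL (f * g).
Proof.
move=> [s ->] [t ->].
exists [seq (a.1 * b.1, (a.2.1 + b.2.1, a.2.2 + b.2.2)) | a <- s, b <- t].
rewrite big_allpairs_dep mulr_suml; apply: eq_bigr => a _.
rewrite mulr_sumr; apply: eq_bigr => b _.
rewrite /mono /= intrM (expfzDr _ _ x_neq0) (expfzDr _ _ y_neq0).
by rewrite mulrACA; congr (_ * _); rewrite mulrACA.
Qed.

Lemma isL_sign (n : int) : isL ((-1) ^ n).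
Proof.
have p k : isL ((-1) ^+ k) by rewrite -(rmorphN1 intr) -rmorphXn; apply: isL_int.
by case: n => k; [exact: p | rewrite NegzE -exprz_inv invrN invr1; exact: p].
Qed.

Lemma isL_det n (A : 'M[ratxy]_n) : (forall i j, isL (A i j)) -> isL (\det A).
Proof.
move=> LA; rewrite /determinant; apply: (big_ind isL) => [||s _].
- by have := isL_int 0.
- exact: isL_add.
apply: isL_mul; first exact: (isL_sign s).
by apply: (big_ind isL) => // [|f g]; [have := isL_int 1 | exact: isL_mul].
Qed.

Lemma isL_nat n : isL n%:R.
Proof. by have := isL_int n; rewrite -pmulrn. Qed.

Lemma isL_opp f : isL f -> isL (- f).
Proof. by move=> Lf; rewrite -mulN1r; apply: (isL_mul (isL_sign 1) Lf). Qed.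

Lemma isL_mx2 a b c d i j :
  isL a -> isL b -> isL c -> isL d -> isL (mx2 a b c d i j).
Proof.
by move=> La Lb Lc Ld; rewrite mxE; case: ifP => _; case: ifP => _;
  [exact: La | exact: Lb | exact: Lc | exact: Ld].
Qed.

Lemma isL_entry D i j : isL ((Mmat D - Pmat D) i j).
Proof.
have Lx n : isL (x ^ n) by have := isL_mono 1 n 0; rewrite mulr1 mul1r.
have Ly n : isL (y ^ n) by have := isL_mono 1 0 n; rewrite mulr1 mul1r.
have L0 : isL 0 := isL_nat 0; have L1 : isL 1 := isL_nat 1.
have Lx1 : isL x := Lx 1; have Ly1 : isL y := Ly 1.
have LxV : isL x^-1 := Lx (-1); have LyV : isL y^-1 := Ly (-1).
rewrite mxE; apply: isL_add; last first.
  by rewrite mxE; apply: isL_opp; rewrite !mxE; apply: isL_nat.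
rewrite /Mmat /mxdiag mxE; case: eqP => [_|_]; last by rewrite mxE; exact: L0.
rewrite conform_mx_id; case: ifP => _; apply: isL_mx2.
- exact: isL_add L1 (isL_opp Lx1).
- exact: isL_opp Ly1.
- exact: isL_opp (isL_mul Lx1 LyV).
- exact: L0.
- exact: L0.
- exact: isL_opp (isL_mul LxV Ly1).
- exact: isL_opp LyV.
- exact: isL_add L1 (isL_opp LxV).
Qed.

Lemma Z_isL D : isL (Z D).
Proof.
rewrite /Z; case: eqP => [_|_]; first exact: isL_nat 0.
by apply: isL_mul; [exact: isL_sign | apply: isL_det => i j; exact: isL_entry].
Qed.

End LaurentClosure.

Lemma Z_laurent D : exists c, Z D == laurent c.
Proof. exact/laurent_of_list/Z_isL. Qed.

Definition Zcoefs (D : diagram) : coefs := xchoose (Z_laurent D).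

Definition Ztilde (D : diagram) : ratxy :=
  if Z D == 0 then 0 else x ^ (- lowest_exponent_x (Zcoefs D)) * Z D.

(* Main.v *)
Require Import Defs.
From mathcomp Require Import all_boot all_order all_algebra.
From mathcomp Require Import all_fingroup fraction finmap zify ring.
Set Implicit Arguments.
Unset Strict Implicit.
Unset Printing Implicit Defensive.
Import Order.TTheory GRing.Theory Num.Theory.
Local Open Scope ring_scope.

(** Part (a) rests on an explicit vector killed by M - P.  For each of the two
    crossing matrices the row vector (1, - y) is fixed by M_+ and by M_-.
    Hence, if the edges carry integers k such that at every crossing the two
    left edges share one value and the two right edges share that value plus
    one, then the row vector with entry (- y)^k on the edge of number k
    satisfies u M = u P, so that det (M - P) = 0 ([Z_classical]).  Such a k is
    an Alexander numbering: geometrically, the winding number of the diagram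
    around a region next to the edge.

    Its existence is the place where planarity enters, in the guise of the
    vanishing of the first cohomology of a surface of genus 0.  For
    permutations e, n of the darts with e then n as face permutation, a rational
    function h on the darts is the difference of an n-invariant and an
    e-invariant function only if the sum of h d - h (e d) over every face
    vanishes.  Both conditions define subspaces whose dimensions are computed
    by counting orbits, and Euler's formula says precisely that the dimensions
    agree; so the condition is also sufficient ([genus0_splitting]).  Applied
    to the function that equals 0 on left half-edges and 1 on right ones, this
    gives a rational numbering of the vertices, and taking floors makes it
    integral ([alexander_numbering]).

    In part (b), P sends half-edges of one summand to half-edges of the same
    summand, so that up to a simultaneous renumbering of rows and columns
    M - P is block diagonal ([det_relabel], [det_dsum]); the writhe is
    additive.  For the normalized polynomial, the lowest exponent of x is the
    order of vanishing at x = 0, an additive valuation on Laurent polynomials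
    ([has_xorder_uniq], [has_xorderM], [laurent_order]); in
    particular it is the same for every family of coefficients that represents
    a given Laurent polynomial. *)

(** * Functions invariant under a relation *)

Section InvariantFunctions.

Variable T : finType.
Implicit Types (r : rel T) (f : T -> rat) (v : 'rV[rat]_#|T|).

Definition row_of f : 'rV[rat]_#|T| := \row_i f (enum_val i).
Definition fun_of v : T -> rat := fun t => v 0 (enum_rank t).

Lemma row_ofK f : fun_of (row_of f) =1 f.
Proof. by move=> t; rewrite /fun_of mxE enum_rankK. Qed.

(** The rows are the indicator functions of the components of [r], so that the
    row space is the space of [r]-invariant functions. *)
Definition invariant_mx r : 'M[rat]_(n_comp r T, #|T|) :=
  \matrix_(i, j) (fingraph.root r (enum_val j) == enum_val i)%:R.

Lemma invariant_connect r f :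
  (forall s t, r s t -> f s = f t) -> forall s t, connect r s t -> f s = f t.
Proof.
move=> inv s t /connectP[p]; elim: p s => [|u p IHp] s /=; first by move=> _ ->.
by case/andP=> /inv -> /IHp; apply.
Qed.

Lemma invariant_mxP r v : connect_sym r ->
  reflect (forall s t, r s t -> fun_of v s = fun_of v t) (v <= invariant_mx r)%MS.
Proof.
move=> sym; apply: (iffP submxP) => [[w ->] s t rst | inv].
  rewrite /fun_of !mxE; apply: eq_bigr => i _; rewrite !mxE !enum_rankK.
  by have /(fingraph.rootP sym)-> : connect r s t by exact: connect1.
pose w : 'rV_(n_comp r T) := \row_i fun_of v (enum_val i).
exists w; apply/rowP => j; rewrite !mxE -{1}[j]enum_valK -/(fun_of v _).
set t := enum_val j.
have Rt : fingraph.root r t \in [predI roots r & T].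
  by rewrite inE /= [X in X && _](roots_root sym).
have [i0 Ei0] : exists i0 : 'I_(n_comp r T), enum_val i0 = fingraph.root r t.
  by exists (enum_rank_in Rt (fingraph.root r t)); rewrite enum_rankK_in.
rewrite (bigD1 i0) //= !mxE Ei0 eqxx mulr1.
rewrite big1 ?addr0 => [|i ne]; last first.
  rewrite !mxE -Ei0; case: eqP => [/enum_val_inj E|]; last by rewrite mulr0.
  by case/eqP: ne.
by apply: invariant_connect inv _ _ _; apply: connect_root.
Qed.

Lemma rank_invariant_mx r : \rank (invariant_mx r) = n_comp r T.
Proof.
apply/eqP; rewrite -[_ == _]/(row_free _); apply/row_freeP.
exists (\matrix_(j, i) (enum_val j == enum_val i)%:R).
apply/matrixP => i k; rewrite !mxE (bigD1 (enum_rank (enum_val k))) //= big1.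
  rewrite !mxE enum_rankK eqxx mulr1 addr0.
  have /andP[/eqP -> _] := enum_valP k.
  by rewrite (inj_eq enum_val_inj) eq_sym.
move=> j ne; rewrite !mxE; case: (enum_val j =P _) => [E|]; last by rewrite mulr0.
by case/eqP: ne; rewrite -E enum_valK.
Qed.

End InvariantFunctions.

(** * Genus zero and exactness *)

Section GenusZero.

Variables (T : finType) (e n : T -> T).
Hypotheses (e_inj : injective e) (n_inj : injective n).
Let face d := n (e d).
Let link : rel T := [rel d d' | (e d == d') || (n d == d')].

Let face_inj : injective face. Proof. by move=> d d' /n_inj/e_inj. Qed.
Let link_sym : connect_sym link.
Proof. by apply: relU_sym; apply: fconnect_sym. Qed.

(** As a map on row vectors, [v |-> v - v \o e]. *)
Let cobound : 'M[rat]_#|T| :=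
  \matrix_(i, j) ((i == j)%:R - (enum_val i == e (enum_val j))%:R).

Let fun_cobound (v : 'rV_#|T|) t : fun_of (v *m cobound) t = fun_of v t - fun_of v (e t).
Proof.
rewrite /fun_of mxE; under eq_bigr do rewrite mxE mulrBr.
rewrite big_split /= (bigD1 (enum_rank t)) //= eqxx mulr1 big1 ?addr0; last first.
  by move=> i /negPf->; rewrite mulr0.
congr (_ + _); rewrite (bigD1 (enum_rank (e t))) //= !enum_rankK eqxx mulr1.
rewrite big1 ?addr0 // => i ne; case: eqP => [E|]; last by rewrite mulr0 oppr0.
by case/eqP: ne; rewrite -E enum_valK.
Qed.

Let fun_cobound_tr (v : 'rV_#|T|) t :
  fun_of (v *m cobound^T) (e t) = fun_of v (e t) - fun_of v t.
Proof.
rewrite /fun_of mxE; under eq_bigr do rewrite !mxE mulrBr.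
rewrite big_split /= (bigD1 (enum_rank (e t))) //= eqxx mulr1 big1 ?addr0; last first.
  by move=> i; rewrite eq_sym => /negPf->; rewrite mulr0.
congr (_ + _); rewrite (bigD1 (enum_rank t)) //= !enum_rankK eqxx mulr1.
rewrite big1 ?addr0 // => i ne; case: eqP => [/e_inj E|]; last by rewrite mulr0 oppr0.
by case/eqP: ne; rewrite E enum_valK.
Qed.

Let inv_fP (f : T -> T) (v : 'rV_#|T|) : injective f ->
  reflect (forall t, fun_of v (f t) = fun_of v t) (v <= invariant_mx (frel f))%MS.
Proof.
move=> f_inj; apply: (iffP (invariant_mxP _ (fconnect_sym f_inj))) => inv.
  by move=> t; apply/esym/inv/eqxx.
by move=> s _ /eqP <-.
Qed.

(** With C components, the space of sums of an n-invariant and an e-invariant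
    function has dimension at least fcard n + fcard e - C, since functions
    invariant under both are constant on components.  The functions h
    satisfying the condition on faces form the orthogonal complement of the
    image of the face-invariant functions under the transpose of [cobound]; a
    face-invariant function in the kernel of that transpose is again constant
    on components, so this complement has dimension at most
    #|T| - (fcard face - C).  The first space lies in the second, and Euler's
    formula equates the two bounds. *)
Lemma genus0_splitting (h : T -> rat) :
  (fcard e T + fcard n T + fcard face T = 2 * n_comp link T + #|T|)%N ->
  (forall k : T -> rat, (forall d, k (face d) = k d) ->
     \sum_d k d * (h d - h (e d)) = 0) ->
  exists f : T -> rat,
    (forall d, f (n d) = f d) /\ (forall d, f (e d) - h (e d) = f d - h d).
Proof.
move=> euler hclosed.
pose Je := invariant_mx (frel e); pose Jn := invariant_mx (frel n).
pose Jf := invariant_mx (frel face).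
have rank_cap m (A : 'M[rat]_(m, #|T|)) :
    (forall v : 'rV_#|T|, (v <= A)%MS ->
      (forall t, fun_of v (e t) = fun_of v t) /\
      (forall t, fun_of v (n t) = fun_of v t)) ->
    (\rank A <= n_comp link T)%N.
  move=> inv; rewrite -rank_invariant_mx; apply: mxrankS; apply/rV_subP => v /inv[ve vn].
  by apply/invariant_mxP => // s t /orP[] /eqP <-.
have capne : (\rank (Jn :&: Je)%MS <= n_comp link T)%N.
  apply: rank_cap => v; rewrite sub_capmx.
  case/andP=> [/(inv_fP _ n_inj) ? /(inv_fP _ e_inj) ?]; by split.
have capf : (\rank (Jf :&: kermx cobound^T)%MS <= n_comp link T)%N.
  apply: rank_cap => v; rewrite sub_capmx => /andP[/(inv_fP _ face_inj) vf].
  move/sub_kermxP => v0; have ve t : fun_of v (e t) = fun_of v t.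
    by apply/eqP; rewrite -subr_eq0 -fun_cobound_tr v0 /fun_of mxE.
  split=> // t; have := vf (finv e t); rewrite /face (f_finv e_inj) => ->.
  by rewrite -ve (f_finv e_inj).
have sumne := mxrank_sum_cap Jn Je.
have mulf := mxrank_mul_ker Jf cobound^T.
pose K := kermx (cobound *m Jf^T).
have rK : (\rank K = #|T| - \rank (Jf *m cobound^T)%R)%N.
  by rewrite mxrank_ker -[in LHS]mxrank_tr trmx_mul trmxK.
have closedK (v : 'rV_#|T|) : (forall k : T -> rat, (forall d, k (face d) = k d) ->
     \sum_d k d * (fun_of v d - fun_of v (e d)) = 0) -> (v <= K)%MS.
  move=> vcl; apply/sub_kermxP; rewrite mulmxA; apply/rowP => i; rewrite !mxE.
  rewrite -[RHS](vcl (fun_of (row i Jf))); last first.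
    by apply/(inv_fP _ face_inj); apply: row_sub.
  rewrite (reindex (@enum_val T T)) /=; last exact/onW_bij/enum_val_bij.
  by apply: eq_bigr => j _; rewrite -fun_cobound /fun_of enum_valK !mxE mulrC.
(* For an n-invariant v, [v (e d) = v (face d)], and the sum against a
   face-invariant k telescopes. *)
have sub : (Jn + Je <= K)%MS.
  rewrite addsmx_sub; apply/andP; split; apply/rV_subP => v.
    move/(inv_fP _ n_inj) => vn; apply: closedK => k kf.
    rewrite (eq_bigr (fun d => k d * fun_of v d - k (face d) * fun_of v (face d))).
      by rewrite sumrB [X in X - _](reindex_inj face_inj) subrr.
    by move=> d _; rewrite mulrBr kf /face vn.
  move/(inv_fP _ e_inj) => ve; apply: closedK => k _.
  by apply: big1 => d _; rewrite ve subrr mulr0.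
have eqK : (Jn + Je == K)%MS.
  rewrite -(mxrank_leqif_eq sub) eqn_leq mxrankS //=.
  rewrite !rank_invariant_mx in sumne mulf; rewrite rK.
  move: sumne mulf capf capne euler.
  move: (\rank (Jn + Je)%MS) (\rank (Jn :&: Je)%MS).
  move: (\rank (Jf *m _)%R) (\rank (Jf :&: _)%MS).
  move: (n_comp link T) (fcard e T) (fcard n T) (fcard face T) #|T|.
  by clear; lia.
have : (row_of h <= Jn + Je)%MS.
  rewrite (eqmxP eqK); apply: closedK => k /hclosed.
  move=> hc; rewrite -[RHS]hc.
  by apply: eq_bigr => d _; rewrite !row_ofK.
case/sub_addsmxP=> -[u w] /= E.
have /(inv_fP _ n_inj) un : (u *m Jn <= Jn)%MS by apply: submxMl.
have /(inv_fP _ e_inj) we : (w *m Je <= Je)%MS by apply: submxMl.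
exists (fun_of (u *m Jn)); split=> // d.
have hE t : h t = fun_of (u *m Jn) t + fun_of (w *m Je) t.
  by rewrite -(row_ofK h) E /fun_of !mxE.
by rewrite !hE we !opprD !addrA !subrr.
Qed.

End GenusZero.

(** * Alexander numberings of plane diagrams *)

Section AlexanderNumbering.

Variables (V : finType) (arc : {perm V * side}).
Implicit Type d : dart V.

Let h d : rat := (val d.1.2)%:R.
(** A potential for the variation of [h] along the edges: its total variation
    around a face is zero. *)
Let p d : rat := h d + d.2%:R.

Let h_step d : h d - h (dart_edge arc d) = p d - p (dart_face arc d).
Proof.
rewrite /p /dart_face.
case: d => -[v a] [] /=; [case: (arc^-1 _)%g | case: (arc _)] => w [[|[|//]] b] //=;
  rewrite /h /=; ring.
Qed.

(** An edge gets the number [m v + a] read at either of its ends, [a] being 0 on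
    the left of [v] and 1 on the right. *)
Lemma alexander_numbering : planar arc ->
  exists m : V -> int, forall h, m (arc h).1 + (arc h).2%:Z = m h.1 + h.2%:Z.
Proof.
move=> euler.
have := genus0_splitting (@dart_edge_inj _ arc) (@dart_node_inj V) euler.
case/(_ h) => [k kf | f [fnode fe]].
  rewrite (eq_bigr (fun d => k d * p d - k (dart_face arc d) * p (dart_face arc d))).
    by rewrite sumrB [X in X - _](reindex_inj (@dart_face_inj _ arc)) subrr.
  by move=> d _; rewrite h_step mulrBr kf.
pose g v := f (v, lft, true).
have fg d : f d = g d.1.1.
  have f1 v : f (v, lft, false) = g v by exact: (fnode (v, lft, true)).
  have f2 v : f (v, rgt, false) = g v by exact: etrans (fnode (v, lft, false)) (f1 v).
  have f3 v : f (v, rgt, true) = g v by exact: etrans (fnode (v, rgt, false)) (f2 v).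
  case: d => [[v a] u] /=; case: (eqVneq a lft) => [->|ne].
    by case: u.
  have -> : a = rgt by apply: val_inj; case: a ne => -[|[|]].
  by case: u.
(* The values [g v] may be fractional, but they differ by integers along edges,
   and the floor commutes with integer translations. *)
exists (fun v => Num.floor (- g v)) => -[v a] /=.
have := fe (v, a, false); rewrite !fg /h /=; case: (arc (v, a)) => w b /= E.
have floorDn (r : rat) (n : nat) : Num.floor r + n%:Z = Num.floor (r + n%:R).
  by rewrite floorDrz ?natr_int // -[n%:R]/(n%:Z%:~R) intrKfloor.
by rewrite !floorDn; congr Num.floor; apply: oppr_inj; rewrite !opprD !opprK.
Qed.

End AlexanderNumbering.

(** * The matrix M - P indexed by half-edges *)

(** A determinant depends only on the set of labels and not on the order in
    which they are listed: rows and columns undergo the same permutation, whose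
    sign is squared. *)
Lemma det_relabel (R : comRingType) (K : finType) (E : K -> K -> R) (m n : nat)
    (f : 'I_m -> K) (g : 'I_n -> K) :
  injective f -> injective g -> codom f =i codom g ->
  \det (\matrix_(i, j) E (f i) (f j)) = \det (\matrix_(i, j) E (g i) (g j)).
Proof.
move=> f_inj g_inj fg.
have emn : m = n.
  by rewrite -[m]card_ord -[n]card_ord -(card_codom f_inj) -(card_codom g_inj) (eq_card fg).
subst n; have fin i : f i \in codom g by rewrite -fg codom_f.
have s_inj : injective (fun i => iinv (fin i)).
  by move=> i j eij; apply: f_inj; rewrite -(f_iinv (fin i)) eij f_iinv.
pose s := perm s_inj.
rewrite (_ : (\matrix_(i, j) _ : 'M_m) =
   row_perm s (col_perm s (\matrix_(i, j) E (g i) (g j)))).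
  rewrite row_permE col_permE !det_mulmx !det_perm odd_permV mulrCA.
  by rewrite -expr2 sqrr_sign mulr1.
by apply/matrixP => i j; rewrite !mxE !permE !f_iinv.
Qed.

Section HalfEdges.

Variable D : diagram.
Implicit Types h k : crossing D * side.

Definition label (I : 'I_(\sum_(i < ncrossings D) 2)) : crossing D * side :=
  (cr (tagnat.sig1 I), tagnat.sig2 I).

(** The coefficient of M - P in the row of [h] and the column of [k].  Making
    sense of it for all half-edges, virtual crossings included, avoids
    transporting it between enumerations of the classical crossings. *)
Definition entry h k : ratxy :=
  (h.1 == k.1)%:R * (if positive h.1 then Mpos else Mneg) h.2 k.2
  - (connect (@virtual_step D) (Defs.arc D k) h)%:R.

Lemma label_inj : injective label.
Proof.
move=> I J [/enum_val_inj e1 e2]; rewrite -[I]tagnat.sigK -[J]tagnat.sigK.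
rewrite !tagnat.sigE12; congr (tagnat.rank _).
move: (tagnat.sig1 I) (tagnat.sig1 J) (tagnat.sig2 I) (tagnat.sig2 J) e1 e2.
by move=> i _ a b <- /= ->.
Qed.

Lemma mem_label h : (h \in codom label) = classical h.1.
Proof.
apply/codomP/idP => [[I ->]|hc]; first exact: (enum_valP (tagnat.sig1 I)).
pose i : 'I_(ncrossings D) := enum_rank_in hc h.1.
exists (@tagnat.Rank _ (fun=> 2) i h.2); rewrite /label /cr tagnat.Rank1K enum_rankK_in //.
rewrite [LHS]surjective_pairing; congr (_, _).
by apply: val_inj; rewrite tagnat.Rank2K.
Qed.

Lemma Z_matrixE : Mmat D - Pmat D = \matrix_(I, J) entry (label I) (label J).
Proof.
apply/matrixP => I J; rewrite !mxE /entry /= /same_edge /cr.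
congr (_ - _).
rewrite (inj_eq enum_val_inj); case: eqP => [e|_]; last by rewrite mul0r mxE.
by rewrite mul1r conform_mx_id.
Qed.

(** This frees the determinant from the particular enumeration of the classical
    crossings and from the block structure of its index type. *)
Lemma det_entry n (g : 'I_n -> crossing D * side) :
  injective g -> (forall h, (h \in codom g) = classical h.1) ->
  \det (Mmat D - Pmat D) = \det (\matrix_(i, j) entry (g i) (g j)).
Proof.
move=> g_inj gC; rewrite Z_matrixE; apply: det_relabel => // [|h].
  exact: label_inj.
by rewrite mem_label gC.
Qed.

End HalfEdges.

(** * Vanishing for diagrams without virtual crossings *)

(** The coordinates of (1, - t) M_+ and (1, - t) M_-, with s for x and t for y. *)
Lemma weight_identities (F : fieldType) (s t : F) : s != 0 -> t != 0 ->
  [/\ 1 - s + - t * - (s * t^-1) = 1, - t + - t * 0 = - t,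
      0 + - t * - t^-1 = 1 & - (s^-1 * t) + - t * (1 - s^-1) = - t].
Proof. by move=> s0 t0; split; field; rewrite ?s0 ?t0. Qed.

(** The row vector (1, - y) is fixed by both crossing matrices: this is why the
    weight of an edge only has to depend on its Alexander number. *)
Lemma Mpos_Mneg_weights (b : bool) (a : side) :
  (if b then Mpos else Mneg) lft a + - y * (if b then Mpos else Mneg) rgt a
  = (- y) ^ a%:Z.
Proof.
have [pl pr nl nr] := weight_identities x_neq0 y_neq0.
by case: b; case: a => [[|[|//]] pa]; rewrite !mxE /= ?expr0z ?expr1z.
Qed.

Lemma Z_classical D : (forall v : crossing D, classical v) -> Z D = 0.
Proof.
move=> Dcl; rewrite /Z; case: ifP => // /negbT nD.
suff -> : \det (Mmat D - Pmat D) = 0 by rewrite mulr0.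
have [m mE] := alexander_numbering (arc_planar D).
rewrite (@det_entry D _ (@enum_val (crossing D * side)%type predT)); first last.
- by move=> h; rewrite Dcl; apply/codomP; exists (enum_rank h); rewrite enum_rankK.
- exact: enum_val_inj.
(* Rows are indexed by incoming half-edges, so [u] is indexed by the edges
   through their heads. *)
apply/eqP/det0P; pose u (h : crossing D * side) : ratxy := (- y) ^ (m h.1 + h.2%:Z).
have yN0 : - y != 0 by rewrite oppr_eq0 y_neq0.
exists (\row_i u (enum_val i)).
  rewrite -lt0n in nD; pose v := cr (Ordinal nD).
  apply/eqP => /rowP/(_ (enum_rank (v, lft))) /eqP; rewrite !mxE.
  by rewrite (negPf (expfz_neq0 _ yN0)).
apply/rowP => j; rewrite !mxE; under eq_bigr do rewrite !mxE.
move: (enum_val j) => k {j}.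
rewrite (reindex (@enum_rank (crossing D * side)%type)) /=; last first.
  exact/onW_bij/enum_rank_bij.
under eq_bigr do rewrite enum_rankK /entry mulrBr.
rewrite sumrB; apply/eqP; rewrite subr_eq0; apply/eqP.
(* [u M = u] by the choice of the weights, and [u P = u] because [m] numbers
   edges consistently. *)
transitivity (u k).
  pose G v a := u (v, a) * ((v == k.1)%:R * (if positive v then Mpos else Mneg) a k.2).
  rewrite (eq_bigr (fun h => G h.1 h.2)) => [|[]] //.
  rewrite -(pair_bigA _ G) /G /=.
  rewrite (bigD1 k.1) //= [X in _ + X]big1 => [|v /negPf nv]; last first.
    by apply: big1 => a _; rewrite nv mul0r mulr0.
  rewrite addr0 big_ord_recl big_ord1 eqxx !mul1r /u /= !(expfzDr _ _ yN0).
  rewrite expr0z expr1z mulr1 -mulrA -mulrDr -(Mpos_Mneg_weights (positive k.1)).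
  by rewrite (_ : lift ord0 ord0 = rgt) //; apply: val_inj.
rewrite (bigD1 (Defs.arc D k)) //= connect0 mulr1 big1 ?addr0.
  by rewrite /u mE.
move=> h ne; case: connectP => [[[|s p] /=]|]; rewrite ?mulr0 //.
  by move=> _ eh; rewrite eh eqxx in ne.
by rewrite /virtual_step /= Dcl.
Qed.

(** * Multiplicativity under disconnected sum *)

Section ConnectEmbed.

Variables (S T : finType) (f : S -> T) (e : rel S) (e' : rel T).
Hypotheses (f_inj : injective f) (eE : forall s t, e' (f s) (f t) = e s t).
Hypothesis eC : forall s t, e' (f s) t -> t \in codom f.

Lemma connect_codom s t : connect e' (f s) t -> t \in codom f.
Proof.
move/connectP=> [p]; elim: p s => [|u p IHp] s /=; first by move=> _ ->; apply: codom_f.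
by case/andP=> /eC/codomP[u' ->]; apply: IHp.
Qed.

Lemma connect_embed s t : connect e' (f s) (f t) = connect e s t.
Proof.
apply/idP/idP; last first.
  case/connectP=> p + ->; elim: p s => [|u p IHp] s /=; first by rewrite connect0.
  by case/andP=> su /IHp; apply: connect_trans; apply: connect1; rewrite eE.
case/connectP=> p; elim: p s => [|u p IHp] s /=.
  by move=> _ /f_inj->; rewrite connect0.
case/andP=> su; have /codomP[u' eu] := eC su; subst u => /IHp H /H.
by apply: connect_trans; apply: connect1; rewrite -eE.
Qed.

End ConnectEmbed.

Section DisconnectedSum.

Variables D1 D2 : diagram.

Let in1 (h : crossing D1 * side) : crossing (dsum D1 D2) * side := (inl h.1, h.2).
Let in2 (h : crossing D2 * side) : crossing (dsum D1 D2) * side := (inr h.1, h.2).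

Let in1_inj : injective in1. Proof. by move=> [v a] [w b] [-> ->]. Qed.
Let in2_inj : injective in2. Proof. by move=> [v a] [w b] [-> ->]. Qed.

Let arc_in1 h : Defs.arc (dsum D1 D2) (in1 h) = in1 (Defs.arc D1 h).
Proof. by rewrite permE /= -surjective_pairing; case: (Defs.arc _ _). Qed.

Let arc_in2 h : Defs.arc (dsum D1 D2) (in2 h) = in2 (Defs.arc D2 h).
Proof. by rewrite permE /= -surjective_pairing; case: (Defs.arc _ _). Qed.

Let step1 h h' : @virtual_step (dsum D1 D2) (in1 h) h' -> h' \in codom in1.
Proof. by case/andP=> _; rewrite (arc_in1 (_, _)) => /eqP <-; apply: codom_f. Qed.

Let step2 h h' : @virtual_step (dsum D1 D2) (in2 h) h' -> h' \in codom in2.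
Proof. by case/andP=> _; rewrite (arc_in2 (_, _)) => /eqP <-; apply: codom_f. Qed.

Let step1E h h' : @virtual_step (dsum D1 D2) (in1 h) (in1 h') = virtual_step h h'.
Proof. by rewrite /virtual_step /= (arc_in1 (_, _)) (inj_eq in1_inj). Qed.

Let step2E h h' : @virtual_step (dsum D1 D2) (in2 h) (in2 h') = virtual_step h h'.
Proof. by rewrite /virtual_step /= (arc_in2 (_, _)) (inj_eq in2_inj). Qed.

Let entry11 h k : entry (in1 h) (in1 k) = entry h k.
Proof.
by rewrite /entry /= arc_in1 (connect_embed in1_inj step1E step1).
Qed.

Let entry22 h k : entry (in2 h) (in2 k) = entry h k.
Proof.
by rewrite /entry /= arc_in2 (connect_embed in2_inj step2E step2).
Qed.

Let entry21 h k : entry (in2 h) (in1 k) = 0.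
Proof.
rewrite /entry /= mul0r sub0r arc_in1;
case: (boolP (connect _ _ _)) => [|_]; last exact: oppr0.
by move/(connect_codom step1)/codomP => [].
Qed.

Let entry12 h k : entry (in1 h) (in2 k) = 0.
Proof.
rewrite /entry /= mul0r sub0r arc_in2;
case: (boolP (connect _ _ _)) => [|_]; last exact: oppr0.
by move/(connect_codom step2)/codomP => [].
Qed.

Lemma det_dsum :
  \det (Mmat (dsum D1 D2) - Pmat (dsum D1 D2)) =
  \det (Mmat D1 - Pmat D1) * \det (Mmat D2 - Pmat D2).
Proof.
pose n1 := (\sum_(i < ncrossings D1) 2)%N; pose n2 := (\sum_(i < ncrossings D2) 2)%N.
pose g (i : 'I_(n1 + n2)) := match split i with
  | inl j => in1 (label j) | inr j => in2 (label j) end.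
rewrite (@det_entry _ _ g); first last.
- move=> [[v|v] a]; have := mem_label (v, a); rewrite /classical /= => <-.
    apply/codomP/codomP => -[i]; last first.
      by move=> va; exists (unsplit (inl i)); rewrite /g unsplitK -va.
    rewrite /g; case: split => j // E; exists j; apply: in1_inj.
    by rewrite -E.
  apply/codomP/codomP => -[i]; last first.
    by move=> va; exists (unsplit (inr i)); rewrite /g unsplitK -va.
  rewrite /g; case: split => j // E; exists j; apply: in2_inj.
  by rewrite -E.
- move=> i j; rewrite /g => E; apply: (can_inj splitK); move: E.
  case: (split i) => i'; case: (split j) => j' //.
    by move/in1_inj/label_inj->.
  by move/in2_inj/label_inj->.
rewrite (_ : \matrix_(i, j) _ = block_mx (Mmat D1 - Pmat D1) 0 0 (Mmat D2 - Pmat D2)).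
  exact: det_ublock.
rewrite !Z_matrixE; apply/matrixP => i j; rewrite !mxE /g.
by case: (split i) => i'; rewrite mxE; case: (split j) => j';
   rewrite !mxE ?entry11 ?entry12 ?entry21 ?entry22.
Qed.

Let card_dsum (P : pred (crossing D1 + crossing D2)) :
  #|P| = (#|[pred v | P (inl v)]| + #|[pred v | P (inr v)]|)%N.
Proof. by rewrite -!sum1_card big_sumType. Qed.

Lemma ncrossings_dsum : ncrossings (dsum D1 D2) = (ncrossings D1 + ncrossings D2)%N.
Proof. exact: card_dsum. Qed.

Lemma writhe_dsum : writhe (dsum D1 D2) = writhe D1 + writhe D2.
Proof.
by rewrite /writhe !card_dsum !PoszD opprD addrACA.
Qed.

(** Without classical crossings, [Z] is 0 by convention whereas the determinant
    of the empty matrix is 1; the hypotheses cover the cases where the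
    convention breaks multiplicativity of the determinant. *)
Lemma Z_dsum :
  (ncrossings D1 = 0%N -> Z D2 = 0) -> (ncrossings D2 = 0%N -> Z D1 = 0) ->
  Z (dsum D1 D2) = Z D1 * Z D2.
Proof.
rewrite /Z det_dsum writhe_dsum ncrossings_dsum addn_eq0.
have N1 : (-1 : ratxy) != 0 by rewrite oppr_eq0 oner_eq0.
rewrite (expfzDr (writhe D1) (writhe D2) N1) mulrACA.
case: (eqVneq (ncrossings D1) 0%N) => [n1 /(_ n1) e2 _|_ _].
  by rewrite mul0r; case: ifP e2 => // _ ->; rewrite mulr0.
by case: (eqVneq (ncrossings D2) 0%N) => [n2 /(_ n2) ->|//]; rewrite !mul0r.
Qed.

End DisconnectedSum.

(** * The lowest exponent of x as a valuation *)

(** [N] is the valuation of [f] at x = 0.  The power of y clears the negative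
    exponents of y, so that the remaining factor is an honest polynomial, whose
    coefficients are polynomials in y. *)
Definition has_xorder (f : ratxy) (N : int) :=
  exists (k : nat) (p : {poly {poly int}}),
    p`_0 != 0 /\ f * y ^+ k = x ^ N * FracField.tofrac p.

(** Two representations with orders N < N' would equate a polynomial with
    nonzero constant coefficient in x to a multiple of x. *)
Lemma has_xorder_ge f N N' : has_xorder f N -> has_xorder f N' -> N' <= N.
Proof.
move=> [k [p [p0 Ep]]] [l [q [_ Eq]]]; rewrite leNgt; apply/negP => lt_NN'.
have [j Ej] : exists j, N' - N = j.+1%:Z.
  by exists `|N' - N|%N.-1; lia.
have /eqP : (x ^ N) * FracField.tofrac (p * ('X ^+ l)%:P) =
            (x ^ N) * FracField.tofrac ('X ^+ j.+1 * (q * ('X ^+ k)%:P)).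
  rewrite !tofracM !rmorphXn /= -/x -/y.
  rewrite [LHS]mulrA -Ep [RHS]mulrA -[x ^+ _]/(x ^ j.+1%:Z) -Ej.
  rewrite -(expfzDr _ _ x_neq0) [N + _]addrC subrK.
  by rewrite [RHS]mulrA -Eq mulrAC.
(* The coefficient of x^0 is nonzero on the left and zero on the right. *)
rewrite (inj_eq (mulfI (expfz_neq0 _ x_neq0))) tofrac_eq => /eqP/(congr1 (coefp 0)) /=.
rewrite coefMC coefXnM /= => /eqP; rewrite mulf_eq0 (negPf p0) /=.
by rewrite expf_eq0 polyX_eq0 andbF.
Qed.

Lemma head_sort_le (s : seq int) : s != [::] ->
  head 0 (sort <=%O s) \in s /\ {in s, forall i, head 0 (sort <=%O s) <= i}.
Proof.
rewrite -size_eq0 -(size_sort <=%O s) => s0.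
have sP i : (i \in s) = (i \in sort <=%O s) by rewrite mem_sort.
have srt := sort_le_sorted s; split=> [|i]; rewrite sP.
  by case: (sort _ s) s0 => // i t _; rewrite mem_head.
case: (sort _ s) srt => //= j t /(order_path_min le_trans)/allP jt.
by rewrite inE => /predU1P[->|/jt].
Qed.

Lemma has_xorder_uniq f N N' : has_xorder f N -> has_xorder f N' -> N = N'.
Proof. by move=> h h'; apply/eqP; rewrite eq_le !(has_xorder_ge h h', has_xorder_ge h' h). Qed.

Lemma has_xorderM f g N N' : has_xorder f N -> has_xorder g N' -> has_xorder (f * g) (N + N').
Proof.
move=> [k [p [p0 Ep]]] [l [q [q0 Eq]]]; exists (k + l)%N, (p * q).
rewrite coef0M mulf_neq0 //; split=> //.
by rewrite exprD mulrACA Ep Eq mulrACA tofracM (expfzDr _ _ x_neq0).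
Qed.

Definition monomial (n : int) (i j : nat) : {poly {poly int}} :=
  ('X ^+ j *~ n)%:P * 'X^i.

Lemma tofrac_monomial n i j :
  FracField.tofrac (monomial n i j) = n%:~R * x ^+ i * y ^+ j.
Proof.
rewrite /monomial tofracM !rmorphXn !raddfMz /= !rmorphXn -/x -/y.
by rewrite mulrzAl -!mulrA mulrzl mulrC.
Qed.

Lemma coef_monomial n i j l :
  (monomial n i j)`_0`_l = if (i == 0%N) && (j == l) then n else 0.
Proof.
rewrite /monomial coefMXn; case: i => [|i] /=; last by rewrite coef0.
rewrite coefC /= coefMrz coefXn eq_sym; case: eqP => _; first exact: intz.
exact: mul0rz.
Qed.

(** Dividing by the lowest power of x leaves as constant coefficient a sum of
    distinct powers of y with nonzero coefficients, where no cancellation can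
    occur. *)
Lemma laurent_order c : laurent c != 0 -> has_xorder (laurent c) (lowest_exponent_x c).
Proof.
move=> c_neq0; set N := lowest_exponent_x c.
have [Nle [e0 e0c e0N]] : (forall e, e \in finsupp c -> N <= e.1) /\
    exists2 e0, e0 \in finsupp c & e0.1 = N.
  have c_supp : [seq e.1 | e <- finsupp c] != [::].
    apply: contraNneq c_neq0 => /(congr1 size)/eqP; rewrite size_map size_eq0 => /eqP E.
    by rewrite /laurent E big_nil.
  have [/mapP[e ec eN] le] := head_sort_le c_supp.
  split; last by exists e.
  by move=> i ic; apply/le/map_f.
(* Any power of y large enough to make all the exponents of y nonnegative. *)
pose k := (\sum_(e <- finsupp c) `|e.2|)%N.
have kP e : e \in finsupp c -> 0 <= e.2 + k%:Z.
  move=> ec; have : (`|e.2| <= k)%N by rewrite /k (big_rem e ec) leq_addr.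
  lia.
pose i (e : int * int) := absz (e.1 - N); pose j (e : int * int) := absz (e.2 + k%:Z).
have iE e : e \in finsupp c -> (i e)%:Z = e.1 - N.
  by move=> ec; rewrite gez0_abs // subr_ge0 Nle.
have jE e : e \in finsupp c -> (j e)%:Z = e.2 + k%:Z.
  by move=> ec; rewrite gez0_abs // kP.
exists k, (\sum_(e <- finsupp c) monomial (c e) (i e) (j e)); split; last first.
  rewrite /laurent mulr_suml (big_morph _ (@tofracD _) (tofrac0 _)) mulr_sumr.
  apply: eq_big_seq => e ec.
  rewrite tofrac_monomial !exprnP iE // jE // (expfzDr _ _ y_neq0).
  rewrite [RHS]mulrA [x ^ N * _]mulrCA -(expfzDr _ _ x_neq0) [N + _]addrC subrK.
  by rewrite -[LHS]mulrA.
apply/eqP => /(congr1 (fun q : {poly int} => q`_(j e0))).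
rewrite !coef_sum coef0 (bigD1_seq e0) ?fset_uniq //= coef_monomial eqxx.
rewrite big1_seq ?addr0 => [|e /andP[ne ec]].
  by rewrite /i e0N subrr /= => /eqP; apply/negP; rewrite -mem_finsupp.
rewrite coef_monomial; case: ifP => // /andP[/eqP ie /eqP je].
case/eqP: ne; rewrite [e]surjective_pairing [e0]surjective_pairing e0N.
congr (_, _); first by apply/eqP; rewrite -subr_eq0 -iE // ie.
by apply: (addIr k%:Z); rewrite -!jE // je.
Qed.

Lemma Z_order D : Z D != 0 -> has_xorder (Z D) (lowest_exponent_x (Zcoefs D)).
Proof.
have E : Z D = laurent (Zcoefs D) by exact/eqP/(xchooseP (Z_laurent D)).
by move=> nz; rewrite E; apply: laurent_order; rewrite -E.
Qed.

Lemma shift_orderM (f g : ratxy) (N N1 N2 : int) :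
  (f != 0 -> g != 0 -> N = N1 + N2) ->
  (if f * g == 0 then 0 else x ^ (- N) * (f * g)) =
  (if f == 0 then 0 else x ^ (- N1) * f) * (if g == 0 then 0 else x ^ (- N2) * g).
Proof.
move=> NE; rewrite mulf_eq0.
have [_|f0] := eqVneq f 0; first by rewrite mul0r.
have [_|g0] := eqVneq g 0; first by rewrite mulr0.
by rewrite NE // opprD (expfzDr _ _ x_neq0) mulrACA.
Qed.

Lemma Ztilde_dsum D1 D2 :
  Z (dsum D1 D2) = Z D1 * Z D2 -> Ztilde (dsum D1 D2) = Ztilde D1 * Ztilde D2.
Proof.
move=> ZE; rewrite /Ztilde ZE; apply: shift_orderM => nz1 nz2.
have nz : Z (dsum D1 D2) != 0 by rewrite ZE (mulf_neq0 nz1 nz2).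
apply: has_xorder_uniq (Z_order nz) _.
by rewrite ZE; exact: has_xorderM (Z_order nz1) (Z_order nz2).
Qed.

Theorem theorem3 :
  (forall D : diagram,
      (forall v : crossing D, classical v) ->
      Z D = 0 /\ Ztilde D = 0) /\
  (forall D1 D2 : diagram,
      (ncrossings D1 = 0%N -> Z D2 = 0) ->
      (ncrossings D2 = 0%N -> Z D1 = 0) ->
      Z (dsum D1 D2) = Z D1 * Z D2 /\
      Ztilde (dsum D1 D2) = Ztilde D1 * Ztilde D2).
Proof.
split=> [D /Z_classical Z0 | D1 D2 n1 n2]; first by rewrite /Ztilde Z0 eqxx.
by have ZE := Z_dsum n1 n2; split=> //; apply: Ztilde_dsum.
Qed.
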